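(* Let $\sigma>0$ with $\mathbb{P}(s_1(\Gamma(X))>\sigma)>0$, assume that $\bar\beta^\sigma=\mathbb{E}^\sigma(\beta)$ is well defined (finite) and that $\rho(\bar\beta^\sigma)\in L^p(\Omega)$ for some $p\in[2,+\infty]$. Then $$\mathrm{Tr}(\mathrm{Cov}^\sigma(\beta))\le\frac{n\,m^2}{\mathbb{P}(s_1(\Gamma(X))>\sigma)^{2/p}}\,K_q^\sigma(\Gamma)\;\|\rho(\bar\beta^\sigma)\|_{L^p(\Omega)}^2,$$ where $q$ is such that $2q^{-1}+2p^{-1}=1$.
   Context: $(\Omega,\mu)$ is a probability space, $n,m\ge1$ are integers, and $f,\gamma_1,\dots,\gamma_n:\Omega\to\mathbb{R}$ are measurable functions. For $a\in\mathbb{R}^n$ the residue is $\rho(a)(x)=f(x)-\sum_{j=1}^n a_j\gamma_j(x)$. $X=(X^{(1)},\dots,X^{(m)})$ where $X^{(1)},\dots,X^{(m)}$ are i.i.d. random points of $\Omega$ with distribution $\mu$. $F(X)=(f(X^{(1)}),\dots,f(X^{(m)}))^T\in\mathbb{R}^m$, and $\Gamma(X)$ is the random $m\times n$ matrix with entries $\Gamma_{ij}(X)=\gamma_j(X^{(i)})$. $s_1(\Gamma(X))$ is the smallest eigenvalue of the symmetric nonnegative matrix $\Gamma(X)^T\Gamma(X)$ (which is not assumed a.s. invertible). On the event $\{s_1(\Gamma(X))>0\}$, $\beta=(\Gamma(X)^T\Gamma(X))^{-1}\Gamma(X)^TF(X)\in\mathbb{R}^n$. $\mathbb{E}^\sigma$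 and $\mathrm{Cov}^\sigma$ denote the expectation and the covariance matrix conditional on the event $\{s_1(\Gamma(X))>\sigma\}$, i.e. $\mathrm{Cov}^\sigma(\beta)=\mathbb{E}^\sigma[(\beta-\bar\beta^\sigma)(\beta-\bar\beta^\sigma)^T]$. For $q\in[1,\infty)$, $K_q^\sigma(\Gamma)=\big[\mathbb{E}^\sigma(s_1(\Gamma(X))^{-q/2})\big]^{2/q}$, and $K_\infty^\sigma(\Gamma)$ is the essential supremum of $s_1(\Gamma(X))^{-1}$ conditionally on $\{s_1(\Gamma(X))>\sigma\}$. Convention $1/\infty=0$, $1/0=\infty$ for exponents. *)

(* Defs.v *)
From HB Require Import structures.
From mathcomp Require Import all_boot all_order all_algebra.
From mathcomp Require Import all_classical all_reals all_analysis.
From mathcomp Require Import ess_sup_inf hoelder random_variable.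

Set Implicit Arguments.
Unset Strict Implicit.
Unset Printing Implicit Defensive.

Import Order.TTheory GRing.Theory Num.Theory.
Import numFieldNormedType.Exports.

Local Open Scope classical_set_scope.
Local Open Scope ring_scope.

Section sampling.
Context {d d' : measure_display} {T : measurableType d}
  {S : measurableType d'} {R : realType}.

Definition mutually_independent (P : probability S R) (m : nat)
    (X : 'I_m -> {mfun S >-> T}) : Prop :=
  forall (J : {set 'I_m}) (B : 'I_m -> set T),
    (forall i, measurable (B i)) ->
    P [set w | forall i, i \in J -> B i (X i w)] =
    (\prod_(i in J) P (X i @^-1` B i))%E.

Definition iid_with_law (P : probability S R) (mu : probability T R)
    (m : nat) (X : 'I_m -> {mfun S >-> T}) : Prop :=
  (forall i B, measurable B -> distribution P (X i) B = mu B) /\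
  mutually_independent P X.

Definition residue (n : nat) (f : T -> R) (gamma : 'I_n -> T -> R)
    (a : 'cV[R]_n) (x : T) : R :=
  f x - \sum_(j < n) a j ord0 * gamma j x.

Definition sampleF (m : nat) (f : T -> R) (X : 'I_m -> {mfun S >-> T})
    (w : S) : 'cV[R]_m :=
  \col_(i < m) f (X i w).

Definition sampleGamma (m n : nat) (gamma : 'I_n -> T -> R)
    (X : 'I_m -> {mfun S >-> T}) (w : S) : 'M[R]_(m, n) :=
  \matrix_(i < m, j < n) gamma j (X i w).

End sampling.

(* The spectrum of a symmetric real matrix of positive size is finite and
   nonempty, so the infimum is attained. *)
Definition smallest_eigenvalue {R : realType} (n : nat) (M : 'M[R]_n) : R :=
  inf [set a | eigenvalue M a].

Definition s1 {R : realType} (m n : nat) (G : 'M[R]_(m, n)) : R :=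
  smallest_eigenvalue (G^T *m G).

(* Meaningful only when G^T *m G is invertible, i.e. when 0 < s1 G. *)
Definition least_squares {R : realType} (m n : nat) (G : 'M[R]_(m, n))
    (F : 'cV[R]_m) : 'cV[R]_n :=
  invmx (G^T *m G) *m G^T *m F.

Section conditioning.
Context {d : measure_display} {S : measurableType d} {R : realType}.
Variables (P : probability S R) (A : set S).

Local Open Scope ereal_scope.

Definition cond_expectation (Y : S -> \bar R) : \bar R :=
  (P A)^-1 * \int[P]_(w in A) Y w.

(* Off A the function is sent to -oo, so that only its values on A count. *)
Definition cond_ess_sup (Y : S -> \bar R) : \bar R :=
  ess_sup P (patch (fun=> -oo) A Y).

Definition cond_mean (n : nat) (Y : S -> 'cV[R]_n) : 'cV[R]_n :=
  \col_(j < n) fine (cond_expectation (fun w => (Y w j ord0)%:E)).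

(* The entries are extended reals: second moments may be infinite. *)
Definition cond_cov (n : nat) (Y : S -> 'cV[R]_n) : 'M[\bar R]_n :=
  \matrix_(i < n, j < n) cond_expectation (fun w =>
    (((Y w - cond_mean Y) *m (Y w - cond_mean Y)^T)%R i j)%:E).

(* K_q for q in [1, +oo]; s w plays the role of s_1(Gamma(X)) *)
Definition Kcond (q : \bar R) (s : S -> R) : \bar R :=
  match q with
  | r%:E => poweR (cond_expectation (fun w => (powR (s w) (- (r / 2)))%:E))
                  (2 / r)%R
  | +oo => cond_ess_sup (fun w => ((s w)^-1)%:E)
  | -oo => 0
  end.

End conditioning.

(* Main.v *)
Require Import Defs.
From HB Require Import structures.
From mathcomp Require Import all_boot all_order all_algebra.
From mathcomp Require Import all_classical all_reals all_analysis.
From mathcomp Require Import ess_sup_inf hoelder random_variable.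
From mathcomp Require Import measurable_realfun.
From mathcomp Require Import ring.

Set Implicit Arguments.
Unset Strict Implicit.
Unset Printing Implicit Defensive.

Import Order.TTheory GRing.Theory Num.Theory.
Import numFieldNormedType.Exports.

Local Open Scope classical_set_scope.
Local Open Scope ring_scope.

(** Fix a sample [w] in [A] and write [G] for the design matrix, [b] for the
    conditional mean and [r] for the vector of the values of [rho b] at the
    sample points. The least-squares solution satisfies the normal equations,
    so [r] is the orthogonal sum of [G (beta - b)] and of the optimal residual,
    and therefore [|G (beta - b)| <= |r|]. As [s1 G] is the minimum of the
    Rayleigh quotient of [G^T G], this gives the pointwise bound
    [|beta - b|^2 <= s1(G)^-1 * \sum_i rho(b)(X_i)^2]
    ([least_squares_stability]).

    The trace of the conditional covariance is the conditional expectation of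
    the left-hand side. Each of the [m] terms on the right is bounded with
    Hoelder's inequality for the conjugate exponents [q/2] and [p/2]
    ([cond_hoelder]): passing from the integral over [A] to the conditional
    expectation costs [1 / P A], of which the power [2/q] is absorbed in the
    normalisation of [Kcond], which leaves [P(A)^(-2/p)]. The norm of
    [rho(b)(X_i)] under [P] is controlled by that of [rho(b)] under [mu],
    since every [X_i] has law [mu] ([Lnorm_comp_le]). The sum over [i] gives
    the factor [m], which is at most [n * m ^ 2].

    The integrals need [A] to be measurable. This follows from the variational
    description of [s1]: the inequality [c <= s1 G] is a conjunction of
    polynomial inequalities in the entries of [G], one for each vector, and by
    continuity rational vectors suffice ([measurable_s1]). *)

(** * Rayleigh quotients *)

Section rayleigh.
Context {R : realType}.
Implicit Types (m n : nat) (c : R).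

Definition dot n (u v : 'rV[R]_n) : R := \sum_j u ord0 j * v ord0 j.

Lemma dotE n (u v : 'rV[R]_n) : dot u v = (u *m v^T) ord0 ord0.
Proof. by rewrite mxE; apply: eq_bigr => j _; rewrite mxE. Qed.

Lemma dotC n (u v : 'rV[R]_n) : dot u v = dot v u.
Proof. by apply: eq_bigr => j _; rewrite mulrC. Qed.

Lemma dotDl n (u v w : 'rV[R]_n) : dot (u + v) w = dot u w + dot v w.
Proof. by rewrite !dotE mulmxDl mxE. Qed.

Lemma dot0l n (u : 'rV[R]_n) : dot 0 u = 0.
Proof. by rewrite dotE mul0mx mxE. Qed.

Lemma dotZl n c (u v : 'rV[R]_n) : dot (c *: u) v = c * dot u v.
Proof. by rewrite !dotE -scalemxAl mxE. Qed.

Lemma dotDr n (u v w : 'rV[R]_n) : dot u (v + w) = dot u v + dot u w.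
Proof. by rewrite dotC dotDl !(dotC _ u). Qed.

Lemma dotZr n c (u v : 'rV[R]_n) : dot u (c *: v) = c * dot u v.
Proof. by rewrite dotC dotZl dotC. Qed.

Lemma dot_ge0 n (u : 'rV[R]_n) : 0 <= dot u u.
Proof. by apply: sumr_ge0 => j _; rewrite -expr2 sqr_ge0. Qed.

Lemma dot_eq0 n (u : 'rV[R]_n) : (dot u u == 0) = (u == 0).
Proof.
apply/idP/eqP => [|->]; last by rewrite dot0l.
rewrite psumr_eq0; last by move=> j _; rewrite -expr2 sqr_ge0.
move=> /allP u0; apply/rowP => j; rewrite mxE.
by have /= := u0 j (mem_index_enum j); rewrite -expr2 sqrf_eq0 => /eqP.
Qed.

Lemma sqnorm_trB n (u v : 'cV[R]_n) :
  dot (u - v)^T (u - v)^T = \sum_j (u j ord0 - v j ord0) ^+ 2.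
Proof. by apply: eq_bigr => j _; rewrite !mxE expr2. Qed.

Lemma dot_mulmx m n (u : 'rV[R]_m) (v : 'rV[R]_n) (A : 'M[R]_(m, n)) :
  dot (u *m A) v = dot u (v *m A^T).
Proof. by rewrite !dotE trmx_mul trmxK mulmxA. Qed.

Lemma continuous_sumr (T : topologicalType) n (f : 'I_n -> T -> R) :
  (forall i, continuous (f i)) -> continuous (fun x => \sum_i f i x).
Proof. by move=> cf; apply: continuous_big => //; exact: add_continuous. Qed.

Lemma continuous_mulmx m n (A : 'M[R]_(m, n)) j :
  continuous (fun u : 'rV[R]_m => (u *m A) ord0 j).
Proof.
rewrite [X in continuous X](_ : _ =
    fun u : 'rV[R]_m => \sum_k u ord0 k * A k j).
  apply: continuous_sumr => k u.
  by apply: continuousM; [exact: coord_continuous|exact: cst_continuous].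
by apply/funext => u; rewrite mxE.
Qed.

Lemma continuous_sqnorm_mulmx m n (A : 'M[R]_(m, n)) :
  continuous (fun u : 'rV[R]_m => dot (u *m A) (u *m A)).
Proof.
by apply: continuous_sumr => j u; apply: continuousM; exact: continuous_mulmx.
Qed.

Lemma continuous_sqnorm n : continuous (fun u : 'rV[R]_n => dot u u).
Proof.
have := @continuous_sqnorm_mulmx n n 1%:M.
by under eq_fun do rewrite mulmx1.
Qed.

Lemma compact_sphere n : compact [set u : 'rV[R]_n | dot u u = 1].
Proof.
apply: (@subclosed_compact _ _
    [set u : 'rV[R]_n | forall i, `[-1, 1]%classic (u ord0 i)]).
- refine (@preimage_closed _ _ (fun u : 'rV[R]_n => dot u u)
    [set x | x = 1] _ (@closed_eq R 1)).
  by move=> u _; exact: continuous_sqnorm.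
- apply: (@rV_compact R n (fun=> `[-1, 1]%classic)) => _.
  exact: segment_compact.
- move=> u /= u1 i; rewrite in_itv /= -ler_norml -(ler_pXn2r (n:=2)) ?nnegrE//.
  rewrite expr1n real_normK ?num_real// -u1 /dot (bigD1 i)//= expr2 lerDl.
  by apply: sumr_ge0 => j _; rewrite -expr2 sqr_ge0.
Qed.

(** The Rayleigh quotient attains its minimum on the unit sphere, which is
    compact; by homogeneity the minimum over the sphere bounds it everywhere. *)
Lemma rayleigh_min m n (A : 'M[R]_(n, m)) : (0 < n)%N ->
  exists2 u0 : 'rV[R]_n, dot u0 u0 = 1 &
    forall u, dot (u0 *m A) (u0 *m A) * dot u u <= dot (u *m A) (u *m A).
Proof.
case: n A => // n A _.
have S0 : [set u : 'rV[R]_n.+1 | dot u u = 1] !=set0.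
  exists (delta_mx ord0 ord0); rewrite /= /dot (bigD1 ord0)//= big1 ?addr0.
    by rewrite mxE !eqxx mulr1.
  by move=> j /negPf j0; rewrite mxE eqxx j0 mulr0.
have [|u0] := EVT_min_rV S0 (@compact_sphere n.+1)
    (f := fun u => dot (u *m A) (u *m A)).
  by apply: continuous_subspaceT; exact: continuous_sqnorm_mulmx.
rewrite inE /= => u01 u0min; exists u0 => // u.
have [->|u_neq0] := eqVneq u 0.
  by rewrite mul0mx !dot0l mulr0.
have u_gt0 : 0 < dot u u by rewrite lt_neqAle eq_sym dot_eq0 u_neq0 dot_ge0.
pose c := (Num.sqrt (dot u u))^-1.
have cc : c * c = (dot u u)^-1 by rewrite -expr2 exprVn sqr_sqrtr// ltW.
have := u0min (c *: u); rewrite inE /= -scalemxAl !dotZl !dotZr !mulrA cc.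
by rewrite mulVf ?gt_eqF// => /(_ erefl); rewrite [leRHS]mulrC ler_pdivlMr.
Qed.

(** First-order condition at a minimiser: a nonnegative form
    [u |-> |u A|^2 - c |u|^2] that vanishes at [u0] has zero gradient there. *)
Lemma rayleigh_eigenvector m n (A : 'M[R]_(n, m)) c (u0 : 'rV[R]_n) :
  (forall u, c * dot u u <= dot (u *m A) (u *m A)) ->
  dot (u0 *m A) (u0 *m A) = c * dot u0 u0 ->
  u0 *m A *m A^T = c *: u0.
Proof.
move=> cmin u0min; set w := u0 *m A *m A^T - c *: u0.
apply/eqP; rewrite -subr_eq0 -/w -dot_eq0 eq_le dot_ge0 andbT.
have ww : dot w w = dot (u0 *m A) (w *m A) - c * dot u0 w.
  by rewrite {1}/w -scaleNr dotDl dotZl mulNr dot_mulmx trmxK.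
clearbody w.
have Q t : 0 <= 2 * t * dot w w
                + t ^+ 2 * (dot (w *m A) (w *m A) - c * dot w w).
  (* The form at u0 + t w, expanded in powers of t: the constant term vanishes
     by u0min, and the linear coefficient is 2 |w|^2 by ww. *)
  have := cmin (u0 + t *: w).
  rewrite -subr_ge0 mulmxDl -scalemxAl !(dotDl, dotDr, dotZl, dotZr) u0min.
  rewrite (dotC w u0) (dotC (w *m A)) ww; move: (dot u0 u0) (dot u0 w) => x y.
  move=> /le_trans; apply; rewrite le_eqVlt; apply/orP; left; apply/eqP.
  by rewrite expr2; ring.
set a := dot w w in Q *; set b := _ - _ in Q.
have b0 : 0 <= b by rewrite subr_ge0 cmin.
have b1 : 0 < b + 1 by rewrite ltr_wpDl.
rewrite leNgt; apply/negP => a0.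
(* The choice t = - a / (b + 1) makes the linear term win over the quadratic
   one, also when b = 0. *)
have := Q (- a / (b + 1)).
rewrite (_ : _ + _ = - (a / (b + 1)) ^+ 2 * (b + 2)); last first.
  by field; rewrite gt_eqF.
by rewrite mulNr oppr_ge0 leNgt mulr_gt0 ?exprn_gt0 ?divr_gt0// ltr_wpDl.
Qed.

(** The minimiser of the Rayleigh quotient is an eigenvector, and the quotient
    takes the value [a] at every eigenvector for [a]: its minimum is thus the
    least element of the spectrum. *)
Lemma s1_eigenvector m n (G : 'M[R]_(m, n)) : (0 < n)%N ->
  exists2 u0 : 'rV[R]_n, dot u0 u0 = 1 & u0 *m (G^T *m G) = s1 G *: u0 /\
    forall u, s1 G * dot u u <= dot (u *m G^T) (u *m G^T).
Proof.
move=> n0; have [u0 u01 u0min] := rayleigh_min G^T n0.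
pose c := dot (u0 *m G^T) (u0 *m G^T).
have u0c : u0 *m (G^T *m G) = c *: u0.
  rewrite mulmxA -{2}(trmxK G).
  by apply: rayleigh_eigenvector => //; rewrite u01 mulr1.
have lbc : lbound [set a | eigenvalue (G^T *m G) a] c.
  move=> a /eigenvalueP[u ua u_neq0].
  have := u0min u; rewrite -/c dot_mulmx trmxK -mulmxA ua dotZr ler_pM2r//.
  by rewrite lt_neqAle eq_sym dot_eq0 u_neq0 dot_ge0.
have ec : [set a | eigenvalue (G^T *m G) a] c.
  apply/eigenvalueP; exists u0 => //; rewrite -dot_eq0 u01; exact: oner_neq0.
have s1c : s1 G = c.
  apply/le_anti/andP; split; last by apply: lb_le_inf => //; exists c.
  by apply: ge_inf => //; exists c.
by exists u0 => //; rewrite s1c.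
Qed.

Lemma s1_rayleigh m n (G : 'M[R]_(m, n)) (u : 'rV[R]_n) : (0 < n)%N ->
  s1 G * dot u u <= dot (u *m G^T) (u *m G^T).
Proof. by move=> n0; have [? _ [_]] := s1_eigenvector G n0. Qed.

(** A description of [s1] that does not mention eigenvalues: it gives both the
    measurability and the nonnegativity of [s1]. *)
Lemma le_s1P m n (G : 'M[R]_(m, n)) c : (0 < n)%N ->
  c <= s1 G <-> forall u, c * dot u u <= dot (u *m G^T) (u *m G^T).
Proof.
move=> n0; split => [cs u|cmin].
  by apply: le_trans (s1_rayleigh G u n0); rewrite ler_wpM2r// dot_ge0.
have [u0 u01 [u0s _]] := s1_eigenvector G n0.
have := cmin u0.
by rewrite dot_mulmx trmxK -mulmxA u0s dotZr u01 !mulr1.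
Qed.

Lemma gram_unitmx m n (G : 'M[R]_(m, n)) : (0 < n)%N -> 0 < s1 G ->
  G^T *m G \in unitmx.
Proof.
move=> n0 s0; rewrite unitmxE unitfE; apply/negP => /det0P[u u_neq0 uG].
have := s1_rayleigh G u n0.
rewrite dot_mulmx trmxK -mulmxA uG (_ : dot u 0 = 0); last first.
  by rewrite dotC dot0l.
rewrite leNgt mulr_gt0//.
by rewrite lt_neqAle eq_sym dot_eq0 u_neq0 dot_ge0.
Qed.

(** The least-squares solution [b'] satisfies the normal equations, so
    [F - G b] splits orthogonally as [G (b' - b)] plus the optimal residual;
    hence [|G (b' - b)| <= |F - G b|], and the Rayleigh bound applies to
    [b' - b]. *)
Lemma least_squares_stability m n (G : 'M[R]_(m, n)) (F : 'cV[R]_m)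
    (b : 'cV[R]_n) : (0 < n)%N -> 0 < s1 G ->
  s1 G * dot (least_squares G F - b)^T (least_squares G F - b)^T
  <= dot (F - G *m b)^T (F - G *m b)^T.
Proof.
move=> n0 s0; set v := (_ - b)^T; set r := (F - _)^T.
apply: le_trans (s1_rayleigh G v n0) _.
set w := v *m G^T.
have normal : G^T *m G *m invmx (G^T *m G) *m G^T *m F = G^T *m F.
  by rewrite mulmxV ?gram_unitmx// mul1mx.
have orth : (r - w) *m G = 0.
  apply: trmx_inj; rewrite trmx0 trmx_mul raddfB /= /w /r /v /least_squares.
  rewrite trmx_mul !trmxK.
  by rewrite !mulmxBr !mulmxA normal subrr.
have {orth normal} orth : dot (r - w) w = 0.
  by rewrite /w -dot_mulmx -/w orth dot0l.
clearbody w r; rewrite -[r](subrK w).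
move: (r - w) orth => z orth; rewrite dotDl !dotDr.
by rewrite (dotC w z) orth addr0 add0r lerDr dot_ge0.
Qed.

End rayleigh.

(** * Measurability of the smallest eigenvalue *)

Section measurability.
Context {R : realType}.

(** By continuity [Q] would be negative on a whole ball around a point where it
    is negative, and every ball contains a rational vector. *)
Lemma ge0_of_rat n (Q : 'rV[R]_n -> R) : continuous Q ->
  (forall v : 'rV[rat]_n, 0 <= Q (map_mx ratr v)) -> forall u, 0 <= Q u.
Proof.
move=> cQ Qrat u; rewrite leNgt; apply/negP => Qu.
have /(cQ u)/= : nbhs (Q u) [set x : R | x < 0] by exact: lt_nbhsl.
move=> /nbhs_ballP[e /= e0 eQ].
have /choice[r ru] i :
    exists r : rat, ratr r \in `](u ord0 i - e), (u ord0 i + e)[.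
  by apply: rat_in_itvoo; rewrite ltrBlDr -addrA ltrDl addr_gt0.
have : ball u e (map_mx ratr (\row_i r i)).
  split => // i j; rewrite !mxE (ord1 i) /ball /= ltr_distlC.
  by have := ru j; rewrite in_itv.
by move=> /eQ /=; rewrite ltNge Qrat.
Qed.

(** The set where [c <= s1 (G w)] is the intersection, over the countably many
    rational vectors [v], of the sets where [c |v|^2 <= |G(w) v|^2]. *)
Lemma measurable_s1 d (S : measurableType d) m n (G : S -> 'M[R]_(m, n)) :
  (0 < n)%N -> (forall i j, measurable_fun [set: S] (fun w => G w i j)) ->
  measurable_fun [set: S] (fun w => s1 (G w)).
Proof.
move=> n0 mG; apply: (measurability (@RGenCInfty.G R)) => [|/= _ [_] [c] -> <-].
  exact: RGenCInfty.measurableE.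
pose Q v w := dot (v *m (G w)^T) (v *m (G w)^T) - c * dot v v.
pose F k := if @unpickle 'rV[rat]_n k is Some v
  then [set w | 0 <= Q (map_mx ratr v) w] else setT.
rewrite [X in measurable X](_ : _ = \bigcap_k F k).
  apply: bigcapT_measurable => k; rewrite /F; case: unpickle => // v.
  rewrite -[X in measurable X]setTI.
  rewrite (_ : [set w | _] = (Q (map_mx ratr v)) @^-1` `[0, +oo[); last first.
    by apply/seteqP; split => w /=; rewrite in_itv /= andbT.
  suff mQ : measurable_fun [set: S] (Q (map_mx ratr v)) by exact: mQ.
  apply: measurable_funB => //; apply: measurable_sum => i.
  have mvG : measurable_fun [set: S]
      (fun w => (map_mx ratr v *m (G w)^T) ord0 i).
    under eq_fun do rewrite mxE.
    apply: measurable_sum => j; under eq_fun do rewrite [_^T _ _]mxE.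
    by apply: measurable_funM => //; exact: mG.
  exact: measurable_funM.
rewrite setTI; apply/seteqP; split => w /=; rewrite in_itv /= andbT.
  move=> cs k _; rewrite /F; case: unpickle => // v /=.
  by rewrite subr_ge0; move/(le_s1P (G w) c n0) : cs; exact.
move=> Fw; apply/(le_s1P (G w) c n0) => u; rewrite -subr_ge0 -/(Q u w).
move: u; apply: ge0_of_rat => [u|v].
  exact: (cvgB (@continuous_sqnorm_mulmx _ _ _ (G w)^T u)
    (cvgM (cvg_cst c) (@continuous_sqnorm _ _ u))).
by have := Fw (pickle v) I; rewrite /F pickleK.
Qed.

Lemma s1_ge0 m n (G : 'M[R]_(m, n)) : (0 < n)%N -> 0 <= s1 G.
Proof. by move=> n0; apply/le_s1P => // u; rewrite mul0r dot_ge0. Qed.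

End measurability.

(** * Norms of identically distributed variables *)

Section law.
Context d d' (T : measurableType d) (S : measurableType d') (R : realType).
Variables (P : {measure set S -> \bar R}) (mu : {measure set T -> \bar R}).
Variable X : {mfun S >-> T}.
Hypothesis lawX : forall B, measurable B -> pushforward P X B = mu B.
Local Open Scope ereal_scope.

Lemma ess_sup_comp_le (h : T -> \bar R) : ess_sup P (h \o X) <= ess_sup mu h.
Proof.
apply/ess_supP; have [N [mN N0 hN]] := ess_sup_ge mu h.
exists (X @^-1` N); split; last by move=> w /= hw; exact: hN.
  by rewrite -[X in measurable X]setTI; exact: measurable_funPT.
by rewrite -N0 -lawX.
Qed.

(** For finite exponents this is the change of variables formula. For [+oo], an
    inequality that holds [mu]-almost everywhere is pulled back along [X]. *)
Lemma Lnorm_comp_le p (f : T -> R) : 0 < p -> measurable_fun [set: T] f ->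
  'N[P]_p[EFin \o (f \o X)] <= 'N[mu]_p[EFin \o f].
Proof.
move=> p0 mf; rewrite unlock; case: p p0 => [r| |]// r0.
  rewrite le_eqVlt; apply/orP; left; apply/eqP; congr (_ `^ _).
  transitivity (\int[pushforward P X]_y `|(f y)%:E| `^ r).
    rewrite ge0_integral_pushforward//.
    - apply: (measurableT_comp (measurable_poweR _)).
      by apply: measurableT_comp => //; exact/measurable_EFinP.
    - by move=> y _; exact: poweR_ge0.
  by apply: eq_measure_integral => B mB _; exact: lawX.
have -> : mu [set: T] = P [set: S] by rewrite -lawX.
case: ifPn => // _; exact: (ess_sup_comp_le (abse \o (EFin \o f))).
Qed.

End law.

(** * Hoelder's inequality for conditional expectations *)

Lemma measurable_fun_invr_ge0 d (S : measurableType d) (R : realType)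
    (s : S -> R) : measurable_fun [set: S] s -> (forall w, 0 <= s w) ->
  measurable_fun [set: S] (fun w => (s w)^-1).
Proof.
move=> ms s_ge0; under eq_fun do rewrite -powR_inv1//.
exact: (measurableT_comp (measurable_powR _) ms).
Qed.

Section conditional_hoelder.
Context d (S : measurableType d) (R : realType) (P : probability S R).
Variable A : set S.
Hypotheses (mA : measurable A) (PA_gt0 : (0 < P A)%E).
Local Open Scope ereal_scope.

Lemma le_cond_expectation (f g : S -> \bar R) :
  measurable_fun A f -> measurable_fun A g ->
  (forall w, A w -> 0 <= f w) -> (forall w, A w -> f w <= g w) ->
  cond_expectation P A f <= cond_expectation P A g.
Proof.
move=> mf mg f0 fg; apply: lee_wpmul2l; first by rewrite inve_ge0.
exact: ge0_le_integral.
Qed.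

Lemma cond_expectation_sum n (f : 'I_n -> S -> \bar R) :
  (forall i, measurable_fun A (f i)) ->
  (forall i w, A w -> 0 <= f i w) ->
  \sum_i cond_expectation P A (f i) =
  cond_expectation P A (fun w => \sum_i f i w).
Proof.
move=> mf f0; rewrite /cond_expectation ge0_integral_sum// ge0_sume_distrr//.
by move=> i _; apply: integral_ge0 => w; exact: f0.
Qed.

Lemma sqr_Lnorm (f : S -> \bar R) (t : R) : t != 0%R ->
  'N[P]_t%:E[f] ^+ 2 = (\int[P]_w (`|f w| `^ t)) `^ (2 / t).
Proof.
move=> t0; rewrite unlock expe2 -poweRD; first by rewrite -mulr2n mulr_natl.
by apply: add_neq0_poweRD_def; rewrite -mulr2n mulrn_eq0 /= invr_eq0.
Qed.

Variables s g : S -> R.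
Hypotheses (ms : measurable_fun [set: S] s) (mg : measurable_fun [set: S] g).
Hypotheses (s_ge0 : forall w, (0 <= s w)%R).

Let msV : measurable_fun [set: S] (fun w => (s w)^-1%R).
Proof. exact: measurable_fun_invr_ge0. Qed.

Let prob_fineK : (fine (P A))%:E = P A.
Proof. by rewrite fineK// fin_num_measure. Qed.

Let prob_fine_gt0 : (0 < fine (P A))%R.
Proof. by rewrite -lte_fin prob_fineK. Qed.

(** The essential supremum of a function sent to [-oo] off [A] could be
    negative only if [A] were negligible. *)
Lemma cond_ess_sup_ge0 (f : S -> \bar R) : (forall w, A w -> 0 <= f w) ->
  0 <= cond_ess_sup P A f.
Proof.
move=> f0; rewrite leNgt; apply/negP => K_lt0.
have : P.-negligible A.
  have [N [mN N0 fN]] := ess_sup_ge P (patch (fun=> -oo) A f).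
  exists N; split => // w Aw; apply: fN => /=.
  rewrite /patch mem_set// => /(le_trans (f0 _ Aw)).
  by rewrite leNgt K_lt0.
by move/(measure_negligible mA) => PA0; move: PA_gt0; rewrite PA0 ltxx.
Qed.

(** The case [p = 2], [q = +oo]: [s^-1] is almost everywhere on [A] at most its
    conditional essential supremum, and the integral of [g^2] over [A] is at
    most the squared 2-norm. *)
Lemma cond_hoelder2y :
  cond_expectation P A (fun w => ((s w)^-1 * g w ^+ 2)%R%:E) <=
  (P A)^-1 * Kcond P A +oo s * 'N[P]_2%:E[EFin \o g] ^+ 2.
Proof.
have K0 : 0 <= Kcond P A +oo s.
  by apply: cond_ess_sup_ge0 => w Aw; rewrite lee_fin invr_ge0.
rewrite -muleA; apply: lee_wpmul2l; first by rewrite inve_ge0.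
have -> : 'N[P]_2%:E[EFin \o g] ^+ 2 = \int[P]_w (g w ^+ 2)%:E.
  rewrite sqr_Lnorm ?pnatr_eq0// divff ?pnatr_eq0// poweRe1.
    apply: eq_integral => w _ /=.
    by rewrite powR_mulrn// real_normK ?num_real.
  by apply: integral_ge0 => w _; exact: poweR_ge0.
apply: (@le_trans _ _ (\int[P]_(w in A) (Kcond P A +oo s * (g w ^+ 2)%:E))).
  apply: ae_ge0_le_integral => //.
  - by move=> w Aw; rewrite lee_fin mulr_ge0 ?invr_ge0 ?sqr_ge0.
  - apply/measurable_EFinP; apply: measurable_funTS.
    by apply: measurable_funM => //; exact: measurable_funX.
  - by move=> w Aw; rewrite mule_ge0// lee_fin sqr_ge0.
  - apply: measurable_funTS; apply: emeasurable_funM => //.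
    by apply/measurable_EFinP; exact: measurable_funX.
  - have := ess_sup_ge P (patch (fun=> -oo) A (fun w => ((s w)^-1)%:E)).
    apply: filterS => w /= + Aw; rewrite /patch mem_set// => sK.
    by rewrite EFinM lee_wpmul2r// lee_fin sqr_ge0.
rewrite ge0_integralZl//.
- rewrite lee_wpmul2l// ge0_subset_integral//.
  + by apply/measurable_EFinP; exact: measurable_funX.
  + by move=> w _; rewrite lee_fin sqr_ge0.
- by apply: measurable_funTS; apply/measurable_EFinP; exact: measurable_funX.
- by move=> w _; rewrite lee_fin sqr_ge0.
Qed.

(** The case [p = +oo], [q = 2]: here it is [g^2] that is almost everywhere
    bounded, and the normalising factor is the one already in [Kcond]. *)
Lemma cond_hoelder_y2 :
  cond_expectation P A (fun w => ((s w)^-1 * g w ^+ 2)%R%:E) <=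
  Kcond P A 2%:E s * 'N[P]_+oo[EFin \o g] ^+ 2.
Proof.
rewrite /Kcond divff ?pnatr_eq0// poweRe1; last first.
  apply: mule_ge0; first by rewrite inve_ge0.
  by apply: integral_ge0 => w _; rewrite lee_fin powR_ge0.
rewrite -muleA; apply: lee_wpmul2l; first by rewrite inve_ge0.
rewrite -ge0_integralZr//; last 3 first.
- apply: measurable_funTS; apply/measurable_EFinP.
  exact: (measurableT_comp (measurable_powR _)).
- by move=> w _; rewrite lee_fin powR_ge0.
- by rewrite sqre_ge0.
apply: ae_ge0_le_integral => //.
- by move=> w Aw; rewrite lee_fin mulr_ge0 ?invr_ge0 ?sqr_ge0.
- apply/measurable_EFinP; apply: measurable_funTS.
  by apply: measurable_funM => //; exact: measurable_funX.
- by move=> w _; rewrite mule_ge0 ?lee_fin ?powR_ge0// sqre_ge0.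
- apply: measurable_funTS; apply: emeasurable_funM => //.
  apply/measurable_EFinP.
  exact: (measurableT_comp (measurable_powR _)).
have : \forall w \ae P, `|(g w)%:E| <= 'N[P]_+oo[EFin \o g].
  rewrite (_ : 'N[P]_+oo[_] = ess_sup P (abse \o (EFin \o g))).
    exact: ess_sup_ge.
  rewrite unlock ifT//; apply: (@lt_le_trans _ _ 1%E) => //.
  by rewrite [leRHS](_ : _ = 1%E)//; exact: probability_setT.
apply: filterS => w gw Aw; rewrite EFinM powR_inv1// lee_wpmul2l//.
  by rewrite lee_fin invr_ge0.
rewrite -[(g w ^+ 2)%R]real_normK ?num_real// EFin_expe lee_sqr//.
exact: Lnorm_ge0.
Qed.

(** Hoelder's inequality for the exponents [r / 2] and [t / 2] applied to
    [s^-1] cut off outside [A], and [g^2]. The powers of [P A] combine because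
    [P(A)^-1 = P(A)^(-2/t) * P(A)^(-2/r)]. *)
Lemma cond_hoelder_fin (r t : R) : (0 < r)%R -> (0 < t)%R ->
  (2 / r + 2 / t = 1)%R ->
  cond_expectation P A (fun w => ((s w)^-1 * g w ^+ 2)%R%:E) <=
  (poweR (P A) (2 / t))^-1 * Kcond P A r%:E s * 'N[P]_t%:E[EFin \o g] ^+ 2.
Proof.
move=> r0 t0 rt.
pose f w := (\1_A w * (s w)^-1)%R.
have mf : measurable_fun [set: S] f.
  by apply: measurable_funM => //; exact: measurable_indic.
have mg2 : measurable_fun [set: S] (fun w => g w ^+ 2)%R.
  exact: measurable_funX.
pose J := \int[P]_(w in A) ((s w)^-1 * g w ^+ 2)%:E.
pose I := \int[P]_(w in A) (s w `^ (- (r / 2)))%:E.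
have I0 : 0 <= I by apply: integral_ge0 => w _; rewrite lee_fin powR_ge0.
have JI : J <= I `^ (2 / r) * 'N[P]_t%:E[EFin \o g] ^+ 2.
  have -> : J = 'N[P]_1[EFin \o (f \* (fun w => g w ^+ 2))%R].
    rewrite Lnorm1 /J [LHS]integral_mkcond; apply: eq_integral => w _ /=.
    rewrite patchE /f indicE; case: ifPn => wA; last by rewrite !mul0r normr0.
    by rewrite mul1r ger0_norm// mulr_ge0 ?invr_ge0 ?sqr_ge0.
  have -> : I `^ (2 / r) = 'N[P]_(r / 2)%:E[EFin \o f].
    rewrite unlock invf_div; congr (_ `^ _).
    rewrite /I [LHS]integral_mkcond; apply: eq_integral => w _ /=.
    rewrite patchE /f indicE; case: ifPn => wA; last first.
      by rewrite mul0r normr0 powR0// gt_eqF// divr_gt0.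
    rewrite mul1r ger0_norm ?invr_ge0//.
    by rewrite -[(s w)^-1%R]powR_inv1// -powRrM mulN1r.
  have -> : 'N[P]_t%:E[EFin \o g] ^+ 2 =
            'N[P]_(t / 2)%:E[EFin \o (fun w => g w ^+ 2)%R].
    rewrite sqr_Lnorm ?gt_eqF// unlock invf_div; congr (_ `^ _).
    apply: eq_integral => w _ /=.
    rewrite normrX -powR_mulrn// -powRrM; congr (_ `^ _)%:E.
    by rewrite mulrCA divff ?mulr1 ?pnatr_eq0.
  by apply: hoelder; rewrite ?divr_gt0 ?invf_div.
rewrite /cond_expectation /Kcond /cond_expectation -/J -/I.
apply: le_trans (lee_wpmul2l _ JI) _; first by rewrite inve_ge0.
rewrite muleA; apply: lee_wpmul2r; first by rewrite sqre_ge0.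
rewrite -prob_fineK inver gt_eqF//.
rewrite poweRM//; last by rewrite lee_fin invr_ge0 ltW.
rewrite !poweR_EFin inver gt_eqF ?powR_gt0// muleA -EFinM.
rewrite lee_wpmul2r ?poweR_ge0// lee_fin.
have -> : ((fine (P A))^-1 = fine (P A) `^ (-1))%R by rewrite powR_inv1 ?ltW.
rewrite -powRN -powRrM mulN1r -powRD; last first.
  by rewrite (gt_eqF prob_fine_gt0) implybT.
by rewrite -opprD addrC rt.
Qed.

(** The relation between the exponents leaves three possibilities: both finite,
    [p = 2] with [q = +oo], and [p = +oo] with [q = 2]. *)
Lemma cond_hoelder (p q : \bar R) : 2%:E <= p -> 1 <= q ->
  2%:E * q^-1 + 2%:E * p^-1 = 1 ->
  cond_expectation P A (fun w => ((s w)^-1 * g w ^+ 2)%R%:E) <=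
  (poweR (P A) (fine (2%:E / p)))^-1 * Kcond P A q s *
  'N[P]_p[EFin \o g] ^+ 2.
Proof.
have eq2 (x : R) : (0 < x)%R -> (2 / x = 1)%R -> x = 2%R.
  by move=> x0 /(congr1 ( *%R^~ x)); rewrite mulfVK ?gt_eqF// mul1r.
case: p => [t| |]// p2; case: q => [r| |]// q1.
- rewrite lee_fin in p2; rewrite lee_fin in q1.
  have t0 : (0 < t)%R by apply: lt_le_trans p2.
  have r0 : (0 < r)%R by apply: lt_le_trans q1.
  rewrite !inver !gt_eqF// -!EFinM -EFinD => -[rt].
  exact: cond_hoelder_fin.
- rewrite lee_fin in p2.
  have t0 : (0 < t)%R by apply: lt_le_trans p2.
  rewrite invey mule0 add0e inver gt_eqF// -EFinM => -[/= t2].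
  rewrite t2 (eq2 _ t0 t2) poweRe1//; exact: cond_hoelder2y.
- rewrite lee_fin in q1.
  have r0 : (0 < r)%R by apply: lt_le_trans q1.
  rewrite invey mule0 adde0 inver gt_eqF// -EFinM => -[/= r2] /=.
  rewrite (eq2 _ r0 r2) poweRe0 inve1 mul1e; exact: cond_hoelder_y2.
- by rewrite invey !mule0 adde0 => /esym/eqP; rewrite onee_eq0.
Qed.

End conditional_hoelder.

(** * The covariance bound *)

Theorem proposition4p2 (R : realType)
    (d : measure_display) (T : measurableType d) (mu : probability T R)
    (d' : measure_display) (S : measurableType d') (P : probability S R)
    (n m : nat) (n_ge1 : (1 <= n)%N) (m_ge1 : (1 <= m)%N)
    (f : T -> R) (gamma : 'I_n -> T -> R)
    (mf : measurable_fun [set: T] f)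
    (mgamma : forall j, measurable_fun [set: T] (gamma j))
    (X : 'I_m -> {mfun S >-> T}) (X_iid : iid_with_law P mu X)
    (sigma : R) (sigma_gt0 : 0 < sigma) (p q : \bar R) :
  let s w := s1 (sampleGamma gamma X w) in
  let beta w := least_squares (sampleGamma gamma X w) (sampleF f X w) in
  let A := [set w | sigma < s w] in
  let bbar := cond_mean P A beta in
  let rho := residue f gamma bbar in
  (0 < P A)%E ->
  (forall j, P.-integrable A (fun w => (beta w j ord0)%:E)) ->
  (2%:E <= p)%E ->
  rho \in Lfun mu p ->
  (1 <= q)%E ->
  (2%:E * q^-1 + 2%:E * p^-1 = 1)%E ->
  (\tr (cond_cov P A beta) <=
   (n * m ^ 2)%:R%:E / poweR (P A) (fine (2%:E / p)) *
   Kcond P A q s * ('N[mu]_p [EFin \o rho]) ^+ 2)%E.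
Proof.
move=> s beta A bbar rho PA_gt0 beta_int p2 rhoL q1 pq.
have p_gt0 : (0 < p)%E by apply: lt_le_trans p2; rewrite lte_fin.
have mrho : measurable_fun [set: T] rho.
  apply: measurable_funB => //; apply: measurable_sum => j.
  by apply: measurable_funM => //; exact: measurable_cst.
have ms : measurable_fun [set: S] s.
  apply: measurable_s1 => // i j.
  under eq_fun do rewrite mxE.
  exact: measurableT_comp.
have s_ge0 w : 0 <= s w by exact: s1_ge0.
have s_gt0 w : A w -> 0 < s w by exact: lt_trans.
have mA : measurable A.
  rewrite -[A]setTI (_ : A = s @^-1` `]sigma, +oo[); first exact: ms.
  by apply/seteqP; split => w; rewrite /A /= in_itv /= andbT.
pose C : \bar R := ((poweR (P A) (fine (2%:E / p)))^-1 * Kcond P A q s *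
  ('N[mu]_p [EFin \o rho]) ^+ 2)%E.
have K_ge0 : (0 <= Kcond P A q s)%E.
  case: q q1 {pq C} => [r| |]//= _; first exact: poweR_ge0.
  by apply: cond_ess_sup_ge0 => // w Aw; rewrite lee_fin invr_ge0.
have C_ge0 : (0 <= C)%E.
  by rewrite mule_ge0 ?sqre_ge0// mule_ge0 ?inve_ge0 ?poweR_ge0.
have mrhoX i : measurable_fun [set: S] (rho \o X i) by exact: measurableT_comp.
have hoelderX i :
  (cond_expectation P A (fun w => ((s w)^-1 * rho (X i w) ^+ 2)%:E) <= C)%E.
  have := cond_hoelder mA PA_gt0 ms (mrhoX i) s_ge0 p2 q1 pq.
  move=> /le_trans; apply.
  apply: lee_wpmul2l; first by rewrite mule_ge0 ?inve_ge0 ?poweR_ge0.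
  rewrite lee_sqr ?Lnorm_ge0//; apply: Lnorm_comp_le => // B mB.
  exact: (X_iid.1 i B mB).
have -> : ((n * m ^ 2)%:R%:E / poweR (P A) (fine (2%:E / p)) *
   Kcond P A q s * ('N[mu]_p [EFin \o rho]) ^+ 2 = (n * m ^ 2)%:R%:E * C)%E.
  by rewrite /C !muleA.
(* One term at most C per sample point, and m <= n * m ^ 2. *)
apply: (@le_trans _ _ (m%:R%:E * C)%E); last first.
  by rewrite lee_wpmul2r// lee_fin ler_nat mulnCA leq_pmulr// muln_gt0 n_ge1.
have mbeta j :
    measurable_fun A (fun w => ((beta w j ord0 - bbar j ord0) ^+ 2)%:E).
  apply/measurable_EFinP; apply: measurable_funX; apply: measurable_funB => //.
  by apply/measurable_EFinP; exact: measurable_int (beta_int j).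
have mterm i : measurable_fun A (fun w => ((s w)^-1 * rho (X i w) ^+ 2)%:E).
  apply: measurable_funTS; apply/measurable_EFinP; apply: measurable_funM.
    exact: measurable_fun_invr_ge0.
  by apply: measurable_funX; exact: mrhoX.
have -> : \tr (cond_cov P A beta) = (\sum_j
    cond_expectation P A (fun w => ((beta w j ord0 - bbar j ord0) ^+ 2)%:E))%E.
  apply: eq_bigr => j _; rewrite mxE; congr cond_expectation.
  by apply/funext => w; rewrite mxE big_ord1 !mxE expr2.
rewrite cond_expectation_sum//; last by move=> j w _; rewrite lee_fin sqr_ge0.
apply: (@le_trans _ _ (\sum_i
    cond_expectation P A (fun w => ((s w)^-1 * rho (X i w) ^+ 2)%:E))%E).
  rewrite cond_expectation_sum//; last first.
    by move=> i w _; rewrite lee_fin mulr_ge0 ?invr_ge0 ?sqr_ge0.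
  apply: le_cond_expectation => //.
  - exact: emeasurable_sum.
  - exact: emeasurable_sum.
  - by move=> w _; apply: sume_ge0 => j _; rewrite lee_fin sqr_ge0.
  move=> w Aw; rewrite !sumEFin lee_fin -mulr_sumr mulrC ler_pdivlMr ?s_gt0//.
  rewrite mulrC.
  have := least_squares_stability (sampleF f X w) bbar n_ge1 (s_gt0 w Aw).
  rewrite -/(s w) -/(beta w) !sqnorm_trB => /le_trans; apply.
  rewrite le_eqVlt; apply/orP; left; apply/eqP; apply: eq_bigr => i _.
  rewrite !mxE /rho /residue; congr ((_ - _) ^+ 2).
  by apply: eq_bigr => j _; rewrite mxE mulrC.
apply: (@le_trans _ _ (\sum_(i < m) C)%E).
  by apply: lee_sum => i _; exact: hoelderX.
by rewrite sumr_const card_ord mule_natl.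
Qed.
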